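(* Consider explorations (as defined in the context) of a circular route of length $100$ miles, where the Professor must start at dawn (so that the first ration box he uses is full at the start). The minimum possible duration of an exploration is exactly $23\frac{25}{116}$ days: there is an exploration starting at dawn that takes $23\frac{25}{116}$ days, and every exploration starting at dawn takes at least $23\frac{25}{116}$ days.
   Context: The route is a circle of circumference $100$ miles with a distinguished point, the base (starting point). Food comes in sealed ration boxes; one ration box contains food for exactly one day, i.e. for $20$ miles of walking. At the base there is an unlimited supply of sealed boxes; initially there are no boxes elsewhere. The Professor walks along the circle at $20$ miles per day, in either direction, and may turn around at any moment (so miles may be wasted by walking back and forth). He eats continuously while walking, at a rate of one ration per $20$ miles, out of one opened box, the box in use, which he must have with him while walking. He opens (unseals) a new box only when the box in use has been completely consumed; the new box must be at his current position (lying there, or carried by him). He can carry at most two boxes at any time, and the box in use counts as one of them; so while walking he carries at most one sealed box in addition to the box in use. He may drop a sealed box at any point and pick up sealed boxes lying at his current position. Food may not be transferred between boxes. An exploration is such a walk which starts at the base, ends at the base, and visits every point of the circle. Its duration in days is the number of miles walked divided by $20$. Starting at dawn means that the first box in use is a full box, opened at the base at the start; hence a new box is opened exactly after every $20$ miles of walking. The last box in use need not be completely consumed. *)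

(* Defs.v *)
From mathcomp Require Import all_boot all_order all_algebra.
From mathcomp Require Import reals.

Set Implicit Arguments.
Unset Strict Implicit.
Unset Printing Implicit Defensive.

Import Order.TTheory GRing.Theory Num.Theory.
Local Open Scope ring_scope.

(* Distances are in miles.  A point of the circular route is given by any real
   coordinate representing it, so that coordinates differing by a multiple of
   the circumference 100 name the same point; the base is the point of 0. *)
Definition same_point (R : realType) (x y : R) : bool :=
  (x - y) / 100 \is a Num.int.

Definition at_base (R : realType) (x : R) : bool := same_point x 0.

Record state (R : realType) := State {
  pos : R;         (* coordinate of the current position *)
  food : R;        (* miles that can still be walked on the box in use *)
  sealed : nat;    (* sealed boxes carried, not counting the box in use *)
  lying : seq R    (* coordinates of the sealed boxes lying along the route;
                      the supply available at the base is not listed *)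
}.

(* [Walk d] goes |d| miles without turning, in the direction of the sign of
   [d]; every other action takes place at the current position. *)
Variant action (R : realType) :=
  | Walk of R
  | Drop
  | PickUp
  | Unseal.

Arguments Drop {R}.
Arguments PickUp {R}.
Arguments Unseal {R}.

(* A sealed box is taken from the ground at [x], which changes the boxes lying
   along the route from [b] to [b']; the supply at the base is unlimited. *)
Definition take_lying (R : realType) (x : R) (b b' : seq R) : Prop :=
  (at_base x /\ b' = b) \/
  (exists y : R, [/\ y \in b, same_point y x & b' = rem y b]).

Inductive step (R : realType) : state R -> action R -> state R -> Prop :=
  | step_walk (x f : R) (n : nat) (b : seq R) (d : R) :
      `|d| <= f ->
      step (State x f n b) (Walk d) (State (x + d) (f - `|d|) n b)
  | step_drop (x f : R) (n : nat) (b : seq R) :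
      step (State x f n.+1 b) Drop (State x f n (x :: b))
  | step_pickup (x f : R) (n : nat) (b b' : seq R) :
      (* the new box, the [n] sealed ones and the box in use: at most two *)
      (1 + n + 1 <= 2)%N ->
      take_lying x b b' ->
      step (State x f n b) PickUp (State x f n.+1 b')
  | step_unseal_carried (x : R) (n : nat) (b : seq R) :
      step (State x 0 n.+1 b) Unseal (State x 20 n b)
  | step_unseal_lying (x : R) (n : nat) (b b' : seq R) :
      take_lying x b b' ->
      step (State x 0 n b) Unseal (State x 20 n b').

Inductive run (R : realType) : state R -> seq (action R) -> state R -> Prop :=
  | run_nil (s : state R) : run s [::] s
  | run_cons (s t u : state R) (a : action R) (w : seq (action R)) :
      step s a t -> run t w u -> run s (a :: w) u.

(* At dawn: at the base, with a full box in use and no box elsewhere. *)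
Definition dawn (R : realType) : state R := State 0 20 0%N [::].

Fixpoint visits (R : realType) (x : R) (w : seq (action R)) (y : R) : Prop :=
  match w with
  | [::] => same_point x y
  | Walk d :: w' =>
      (exists t : R, 0 <= t <= 1 /\ same_point (x + t * d) y) \/
      visits (x + d) w' y
  | _ :: w' => visits x w' y
  end.

Definition exploration_from_dawn (R : realType) (w : seq (action R)) : Prop :=
  (exists s : state R, run (dawn R) w s /\ at_base (pos s)) /\
  (forall y : R, visits 0 w y).

Definition miles (R : realType) (w : seq (action R)) : R :=
  \sum_(a <- w) (if a is Walk d then `|d| else 0).

Definition duration (R : realType) (w : seq (action R)) : R := miles w / 20.

(* Main.v *)
Require Import Defs.
From mathcomp Require Import all_boot all_order all_algebra.
From mathcomp Require Import boolp reals lra.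

Set Implicit Arguments.
Unset Strict Implicit.
Unset Printing Implicit Defensive.

Import Order.TTheory GRing.Theory Num.Theory.
Local Open Scope ring_scope.

(** The lower bound is a bookkeeping argument on the line that covers the
circle, with the base at 0.  A day is the stretch of twenty miles walked on one
box; let P_0 = 0, P_1, ..., P_N be the points where boxes have been opened.

One account is kept for each t >= 0 and concerns the ground beyond t + 10.  A
day that begins at a and ends at b, both below t + 10, leaves at most
(a - t) + (b - t) miles for it, and half of these miles are spent going
outwards, with at most one sealed box.  A box opened beyond t + 10 gives twenty
miles there, but it had to be carried there first.  So with [tent x] = x up to
10 and 20 - x after that, the sum of 2 [tent (P_k - t)] over k < N, plus
[tent (P_N - t)], is nonnegative ([side_supply]), and boxes in store beyond
t + 10 must be paid for in addition ([side_carry]).  The other account is that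
of all miles: each box is carried out once and the way back is walked too,
except for the last way out, so that the miles bound twice the sum of the
distances of all boxes from the base ([side_miles]).

The accounts are kept until the Professor comes round: up to a reflection, he
is on the positive side and either takes a box that was left there from the
negative side, at distance d from the base, or reaches 100.  If he never does,
he has been at distances adding up to 100 on the two sides and has come back
from both, which takes 480 miles ([return_bound]).  Otherwise let g = P_N.  From
there he has 100 - g miles to go, so the total is at least 20 N + 100 - g; the
box of g brings him at most to g + 20, hence d >= 80 - g; and he cannot come
home, if 60 - g is positive, unless there is yet another box, at distance at
least 60 - g ([spare_box]).  The opening before g is at g - 20 or further; by the
first account, with t equal to 0 and to the second, fourth and sixth largest of
the other openings, this forces the sum of those others to be large
([outbound_cost]).  The depot at distance d was founded in
a day that went there and back, from a to b with a + b >= 2 d - 20, and these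
two openings had to be supplied in their turn ([founded_sum]).  Together with
the account of all miles ([total_from_costs]), N <= 20 and N >= 22 contradict a
total below 460 + 125/29, and N = 21 gives 80 - g >= 20 + 125/29.

For the converse a schedule is given on a grid of mesh 5/116 miles, in which no
mile is wasted: the inequalities that decide the case N = 21 become equalities. *)

Lemma map_rem_inj (T U : eqType) (f : T -> U) y (b : seq T) : injective f ->
  map f (rem y b) = rem (f y) (map f b).
Proof. by move=> fi; elim: b => //= z b IH; rewrite (inj_eq fi); case: eqP => //= _; rewrite IH. Qed.

Section LowerBound.
Variable R : realType.
Implicit Types (x y t c d e r : R) (h l b : seq R) (s u : state R) (w : seq (action R)).

(** * Tents, and the cost of the openings on one side *)

Definition pospart x : R := Num.max x 0.

Variant pospart_spec x : R -> Type :=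
  | PospartPos of 0 <= x : pospart_spec x x
  | PospartNeg of x <= 0 : pospart_spec x 0.

Lemma pospartP x : pospart_spec x (pospart x).
Proof. by rewrite /pospart; case: leP => [x0|/ltW x0]; constructor. Qed.

(** What a box opened x miles beyond t earns for the account of the ground beyond
    t + 10, once as the end of a day and once as the beginning of the next. *)
Definition tent x : R := pospart x - 2 * pospart (x - 10).

Lemma tent_le_pospart x : tent x <= pospart x.
Proof. by rewrite /tent; case: (pospartP x); case: (pospartP (x - 10)) => ? ?; lra. Qed.

Lemma tent_le_id x : 0 <= x -> tent x <= x.
Proof. by rewrite /tent; case: (pospartP x); case: (pospartP (x - 10)) => ? ? ?; lra. Qed.

Lemma tent_le_descent x : tent x <= 20 - x.
Proof. by rewrite /tent; case: (pospartP x); case: (pospartP (x - 10)) => ? ?; lra. Qed.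

Lemma tent_nonpos x : x <= 0 -> tent x = 0.
Proof. by rewrite /tent; case: (pospartP x); case: (pospartP (x - 10)) => ? ? ?; lra. Qed.

Lemma pospart_ge0 x : 0 <= pospart x.
Proof. by case: pospartP. Qed.

Lemma pospart_id x : 0 <= x -> pospart x = x.
Proof. by case: pospartP => // ? ?; lra. Qed.

Lemma pospart_nonpos x : x <= 0 -> pospart x = 0.
Proof. by case: pospartP => // ? ?; lra. Qed.

Lemma sum_nseq0 (f : R -> R) n : f 0 = 0 -> \sum_(y <- nseq n 0) f y = 0.
Proof. by move=> f0; elim: n => [|n IH]; rewrite ?big_nil //= big_cons f0 add0r. Qed.

(** A linear program in q1 >= q2 >= ... .  The inequality for t equal to the
    j-th largest value involves the first j values only; there a tent is
    bounded by its ascent for the values close to t and by its descent for the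
    far ones.  Weights 8/5, 2/5, 2/5, 3/10 for t = q2, q4, q6, 0 prove the first
    bound, weights 7/6, 7/24, 3/8 for t = q2, q4, 0 the second. *)
Lemma tent_bounds_sorted r q1 q2 q3 q4 q5 q6 l :
  all (fun y => 0 <= y) [:: q1, q2, q3, q4, q5, q6 & l] ->
  sorted >=%R [:: q1, q2, q3, q4, q5, q6 & l] ->
  (forall t, 0 <= t -> 3 * (r - t) - 40 <=
     2 * \sum_(y <- [:: q1, q2, q3, q4, q5, q6 & l]) tent (y - t)) ->
  (81 / 10 * r - 204 <= \sum_(y <- [:: q1, q2, q3, q4, q5, q6 & l]) y) /\
  (11 / 2 * r - 475 / 4 <= \sum_(y <- [:: q1, q2, q3, q4, q5, q6 & l]) y).
Proof.
move=> /and5P[p1 p2 p3 p4 /and3P[p5 p6 pl]] /= /and5P[s12 s23 s34 s45 /andP[s56 sl]] H.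
have l_le y : y \in l -> y <= q6.
  move=> yl; have: all (fun z => z <= q6) l by apply: order_path_min sl => ? ? ?; exact: ge_trans.
  by move/allP; apply.
have tl t : q6 <= t -> \sum_(y <- l) tent (y - t) = 0.
  move=> qt; rewrite big_seq big1 // => y /l_le yq; apply: tent_nonpos; lra.
have t0 : \sum_(y <- l) tent (y - 0) <= \sum_(y <- l) y.
  rewrite !big_seq; apply: ler_sum => y /(allP pl) y0; rewrite subr0; exact: tent_le_id.
have l0 : 0 <= \sum_(y <- l) y by rewrite big_seq sumr_ge0 // => y /(allP pl).
have tz x y : x <= y -> tent (x - y) = 0 by move=> xy; apply: tent_nonpos; lra.
have [s13 s24 s35 s46] : [/\ q3 <= q1, q4 <= q2, q5 <= q3 & q6 <= q4] by split; lra.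
have [s14 s25 s36 s26] : [/\ q4 <= q1, q5 <= q2, q6 <= q3 & q6 <= q2] by split; lra.
have [s16 s45' s56'] : [/\ q6 <= q1, q5 <= q4 & q6 <= q5] by split; lra.
(* The tents of the values up to t vanish. *)
have := H q2 p2; rewrite !big_cons tl // (tz q2) // (tz q3) // (tz q4) // (tz q5) // (tz q6) // => c0.
have := H q4 p4; rewrite !big_cons tl // (tz q4) // (tz q5) // (tz q6) // => c1.
have := H q6 p6; rewrite !big_cons tl // (tz q6) // => c2.
have := H 0 (lexx _); rewrite !big_cons => cX.
have a1 := @tent_le_id (q1 - q2); have a2 := @tent_le_descent (q1 - q4).
have a3 := @tent_le_id (q2 - q4); have a4 := @tent_le_id (q3 - q4).
have a5 := @tent_le_descent (q1 - q6); have a6 := @tent_le_descent (q2 - q6).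
have a7 := @tent_le_id (q3 - q6); have a8 := @tent_le_id (q4 - q6).
have a9 := @tent_le_id (q5 - q6).
have b1 := @tent_le_id (q1 - 0); have b2 := @tent_le_id (q2 - 0).
have b3 := @tent_le_id (q3 - 0); have b4 := @tent_le_id (q4 - 0).
have b5 := @tent_le_id (q5 - 0); have b6 := @tent_le_id (q6 - 0).
have d1 := @tent_le_descent (q1 - 0); have d2 := @tent_le_descent (q2 - 0).
have d3 := @tent_le_descent (q3 - 0); have d4 := @tent_le_descent (q4 - 0).
have d5 := @tent_le_descent (q5 - 0); have d6 := @tent_le_descent (q6 - 0).
move: a1 a3 a4 a7 a8 a9 b1 b2 b3 b4 b5 b6.
rewrite !subr_ge0 => /(_ ltac:(done)) a1 /(_ ltac:(done)) a3 /(_ ltac:(done)) a4 /(_ ltac:(done)) a7.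
move=> /(_ ltac:(done)) a8 /(_ ltac:(done)) a9 /(_ p1) b1 /(_ p2) b2 /(_ p3) b3 /(_ p4) b4 /(_ p5) b5 /(_ p6) b6.
rewrite ?big_cons; move: t0 cX; set S0 := \sum_(y <- l) tent (y - 0) => t0 cX; set S := \sum_(y <- l) y in l0 t0 *.
clear H tl l_le sl pl.
rewrite !subr0 in b1 b2 b3 b4 b5 b6 d1 d2 d3 d4 d5 d6 cX.
split; lra.
Qed.

Lemma tent_bounds r l :
  (forall y, y \in l -> 0 <= y) ->
  (forall t, 0 <= t -> 3 * (r - t) - 40 <= 2 * \sum_(y <- l) tent (y - t)) ->
  (81 / 10 * r - 204 <= \sum_(y <- l) y) /\
  (11 / 2 * r - 475 / 4 <= \sum_(y <- l) y).
Proof.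
move=> l0 H; set k := sort >=%R (l ++ nseq 6 0).
have kl (f : R -> R) : f 0 = 0 -> \sum_(y <- k) f y = \sum_(y <- l) f y.
  move=> f0; rewrite (perm_big (l ++ nseq 6 0)); last by rewrite perm_sort.
  by rewrite big_cat /= (sum_nseq0 6 f0) addr0.
have k0 : all (fun y => 0 <= y) k.
  apply/allP => y; rewrite mem_sort mem_cat => /orP[/l0 //|].
  by rewrite mem_nseq => /eqP->.
have ks : sorted >=%R k by apply: sort_sorted => ? ?; exact: ge_total.
have kH t : 0 <= t -> 3 * (r - t) - 40 <= 2 * \sum_(y <- k) tent (y - t).
  move=> t0; rewrite (kl (fun y => tent (y - t))); first exact: H.
  by apply: tent_nonpos; lra.
have : (6 <= size k)%N by rewrite size_sort size_cat size_nseq leq_addl.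
rewrite -(kl id) //; clear kl H l0.
case: k k0 ks kH => [|q1 [|q2 [|q3 [|q4 [|q5 [|q6 k]]]]]] // k0 ks kH _.
exact: tent_bounds_sorted k0 ks kH.
Qed.

(** [h] lists the openings, the latest first.  A day that leads from [pa] to [pb]
    and visits a point at distance [d] walks 2 d - pa - pb miles at least.  If at
    the end of this day a box is left at distance [d] and another one is opened
    at [pb], then both, and the boxes opened before, had to be supplied by the
    days up to that one; this is the last clause. *)
Definition founded d h := exists h1 pb pa h2,
  [/\ h = h1 ++ [:: pb, pa & h2], 2 * d - 20 <= pa + pb &
      forall t, 0 <= t ->
        2 * (d - 10 - t) <= 2 * \sum_(y <- pa :: h2) tent (y - t) + tent (pb - t)].

Definition toured d h := exists h1 pb pa h2,
  h = h1 ++ [:: pb, pa & h2] /\ 2 * d - 20 <= pa + pb.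

Lemma sum_pospart_ge0 h : 0 <= \sum_(y <- h) pospart y.
Proof. by apply: sumr_ge0 => y _; exact: pospart_ge0. Qed.

(** The difference of the two sums is a sum of the nonnegative terms
    [2 * pospart (y - 10)], of which the two openings of the day that visits [d]
    give 4 d - 80. *)
Lemma toured_sum d h : toured d h ->
  4 * d - 80 + \sum_(y <- h) tent y <= \sum_(y <- h) pospart y.
Proof.
move=> [h1 [pb [pa [h2 [-> V]]]]]; rewrite !big_cat !big_cons /=.
have dom (l : seq R) : \sum_(y <- l) tent y <= \sum_(y <- l) pospart y.
  by apply: ler_sum => y _; exact: tent_le_pospart.
have := dom h1; have := dom h2.
move: (\sum_(y <- h1) _) (\sum_(y <- h2) _) (\sum_(y <- h1) _) (\sum_(y <- h2) _).
by move=> a b a' b'; rewrite /tent; case: (pospartP pa); case: (pospartP pb);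
  case: (pospartP (pa - 10)); case: (pospartP (pb - 10)) => ? ? ? ? ? ?; lra.
Qed.

Lemma founded_toured d h : founded d h -> toured d h.
Proof. by move=> [h1 [pb [pa [h2 [-> V _]]]]]; exists h1, pb, pa, h2. Qed.

(** Besides [pa] and [pb], let S be the sum of the openings before the founding
    day.  The supply inequality for t = 0 bounds S below by [pa] and [pb]; the one
    for t = S involves no other opening, and bounds S below when [pa] is small.  If
    [pa] is at least S, the weights are 3/7 and 1/7, and 11/7 for
    [2 * d - 20 <= pa + pb]. *)
Lemma founded_sum d h : founded d h -> 20 <= d -> d <= 28 ->
  (30 * d - 500) / 7 <= \sum_(y <- h) pospart y.
Proof.
move=> [h1 [pb [pa [h2 [-> V H]]]]] d20 d28; rewrite !big_cat !big_cons /=.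
have := sum_pospart_ge0 h1; have S0 := sum_pospart_ge0 h2.
set S1 := \sum_(y <- h1) pospart y; set S := \sum_(y <- h2) pospart y in S0 *.
have := H 0 (lexx _); rewrite big_cons !subr0.
have : \sum_(y <- h2) tent (y - 0) <= S.
  by apply: ler_sum => y _; rewrite subr0 tent_le_pospart.
have := H S S0; rewrite big_cons.
have -> : \sum_(y <- h2) tent (y - S) = 0.
  rewrite big_seq big1 // => y yh; apply: tent_nonpos; rewrite subr_le0 /S (big_rem y yh) /=.
  by have := sum_pospart_ge0 (rem y h2); case: (pospartP y) => ? ?; lra.
set S' := \sum_(y <- h2) tent _.
have := tent_le_descent (pb - S); have := tent_le_descent pb.
have := tent_le_descent pa; have := tent_le_pospart pa.
have := tent_le_pospart (pa - S).
case: (pospartP pa); case: (pospartP pb); case: (pospartP (pa - S)) => ? ? ? ? ? ? ? ? ? ? ? ?; lra.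
Qed.

(** Distance from the base, except that on the positive side nothing counts
    beyond [c]. *)
Definition capdist c y : R := pospart (Num.min y c) + pospart (- y).

(** * The total in terms of the costs *)

(** Beyond its summit a tent descends, so that capping raises it. *)
Lemma tent_cap g t y : 0 <= t -> t <= g - 10 ->
  tent (y - t) <= tent (pospart (Num.min y g) - t).
Proof.
move=> t0 tg; rewrite /tent; case: (leP y g) => yg.
  case: (pospartP y) => ?; [by []|].
  by case: (pospartP (y - t)); case: (pospartP (y - t - 10)); case: (pospartP (0 - t));
    case: (pospartP (0 - t - 10)) => ? ? ? ?; lra.
case: (pospartP g) => ?.
  by case: (pospartP (y - t)); case: (pospartP (y - t - 10)); case: (pospartP (g - t));
    case: (pospartP (g - t - 10)) => ? ? ? ?; lra.
lra.
Qed.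

Lemma tent_cap_ge0 g t y : g - 10 <= t -> 0 <= t -> 0 <= g -> 0 <= tent (pospart (Num.min y g) - t).
Proof.
move=> tg t0 g0; have : pospart (Num.min y g) <= g.
  by case: (leP y g); case: pospartP => ? ?; lra.
rewrite /tent; move: (pospart _) => z zg.
by case: (pospartP (z - t)); case: (pospartP (z - t - 10)) => ? ?; lra.
Qed.

(** The tents of the openings at [g'] and at [g] are bounded by their descents, which
    are low for small t: the other openings, [h], have to make up for it.  This holds
    for their distances capped at [g] as well: either [g] is beyond the summits of the
    tents, or the capped tents are nonnegative and the required sum is negative. *)
Lemma outbound_cost g g' h : 0 <= g -> g - 20 <= g' ->
  (forall t, 0 <= t -> 0 <= 2 * \sum_(y <- g' :: h) tent (y - t) + tent (g - t)) ->
  (81 / 10 * (g - 20) - 204 <= \sum_(y <- h) pospart (Num.min y g)) /\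
  (11 / 2 * (g - 20) - 475 / 4 <= \sum_(y <- h) pospart (Num.min y g)).
Proof.
move=> g0 gg' H; rewrite -!(big_map (fun y => pospart (Num.min y g)) xpredT id).
apply: tent_bounds => [y /mapP[z _ ->]|t t0]; first exact: pospart_ge0.
rewrite big_map; case: (leP t (g - 10)) => tg; last first.
  have : 0 <= \sum_(y <- h) tent (pospart (Num.min y g) - t).
    by apply: sumr_ge0 => y _; apply: tent_cap_ge0 => //; apply: ltW.
  lra.
have : \sum_(y <- h) tent (y - t) <= \sum_(y <- h) tent (pospart (Num.min y g) - t).
  by apply: ler_sum => y _; exact: tent_cap.
have := H t t0; rewrite big_cons.
have := tent_le_descent (g' - t); have := tent_le_descent (g - t).
lra.
Qed.

(** All that is needed about the past at the moment the Professor comes round: [g]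
    is the last opening, [h] the earlier ones with the latest first, [d] the distance
    of the depot he finds ([d = 0] when he reaches the base itself), and [spare] bounds
    the distance of the other box that he needs to come home. *)
Lemma total_from_costs g d spare T h :
  30 <= g -> 80 - g <= d -> 0 <= spare -> 60 - g <= spare ->
  (if h is g' :: _ then g - 20 <= g' else True) ->
  (forall t, 0 <= t -> 0 <= 2 * \sum_(y <- h) tent (y - t) + tent (g - t)) ->
  0 <= d ->
  5 * d - 90 <= \sum_(y <- h) pospart (- y) ->
  (20 <= d -> d <= 28 -> (30 * d - 500) / 7 <= \sum_(y <- h) pospart (- y)) ->
  2 * \sum_(y <- h) capdist g y + 80 + d + 2 * spare <= 20 * (size h)%:R ->
  20 * (size h)%:R + 100 - g <= T ->
  460 + 125 / 29 <= T.
Proof.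
move=> g30 gd th0 th; case: h => [|g' h]; first by rewrite !big_nil /= => *; lra.
move=> /= gg' Ha d0 LA LB D2 D1.
have L0 : 0 <= \sum_(y <- h) pospart (- y) by apply: sumr_ge0 => y _; exact: pospart_ge0.
have g0 : 0 <= g by lra.
have [RA RB] := outbound_cost g0 gg' Ha; clear Ha.
move: L0 LA LB D2 D1; rewrite !big_cons big_split /=.
have -> : pospart (- g') = 0 by apply: pospart_nonpos; lra.
have : g - 20 <= capdist g g'.
  by rewrite /capdist; case: (leP g' g) => ?; case: (pospartP (- g')) => ?; rewrite pospart_id; lra.
move: RA RB; move: (capdist g g') (\sum_(y <- h) _) (\sum_(y <- h) _) => p Q L.
set N := (size h).+1 => RA RB pg L0 LA LB D2 D1.
rewrite leNgt; apply/negP => TT.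
(* By the second bound of outbound_cost and 5 d - 90: a contradiction for all g. *)
case: (leqP N 20) => N20.
  have : N%:R <= 20 :> R by rewrite (ler_nat _ N 20).
  lra.
(* The case of the optimum; 5 d - 90 gives d <= 28, so that the sharp cost applies. *)
case: (leqP N 21) => N21.
  have NE : N%:R = 21%:R :> R by congr _%:R; apply/eqP; rewrite eqn_leq N20 N21.
  rewrite NE in D1 D2.
  have d28 : d <= 28 by lra.
  case: (leP 20 d) => d20; last by lra.
  have := LB d20 d28; lra.
(* Now 80 - g is below 5, and the way out is too expensive. *)
have : 22 <= N%:R :> R by rewrite (ler_nat _ 22 N).
lra.
Qed.

(** * The accounts and how the actions change them *)

(** Total weight of the sealed boxes in store, [n] of them carried at [x] and the
    others lying at [b]. *)
Definition stock f n x b : R := n%:R * f x + \sum_(y <- b) f y.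

Lemma stock_ge0 f n x b : (forall y, 0 <= f y) -> 0 <= stock f n x b.
Proof.
by move=> f0; rewrite addr_ge0 ?mulr_ge0 ?ler0n //; apply: sumr_ge0 => y _.
Qed.

Lemma stock_le f1 f2 n x b : (forall y, f1 y <= f2 y) -> stock f1 n x b <= stock f2 n x b.
Proof.
move=> f12; apply: lerD; first by rewrite ler_wpM2l ?ler0n.
by apply: ler_sum => y _.
Qed.

Lemma stock_scale c f n x b : stock (fun y => c * f y) n x b = c * stock f n x b.
Proof. by rewrite /stock mulrDr mulr_sumr mulrCA. Qed.

Lemma stock_walk f n x d b :
  stock f n (x + d) b = stock f n x b + n%:R * (f (x + d) - f x).
Proof. by rewrite /stock mulrBr; lra. Qed.

(** The accounts of the positive side of the line: [P] is the last opening, [h] lists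
    the earlier ones with the latest first, [m] is the number of miles walked since,
    [top] is the farthest point visited, [n] boxes are carried at the present
    position [x] and [b] lists those that lie on the way.  The negative side has
    the same accounts for the reflected data. *)
Record side h (P m top : R) n x b : Prop := Side {
  side_step : `|x - P| <= m;
  side_day : m <= 20;
  side_prev : if h is P' :: _ then P - 20 <= P' else True;
  (* The last term bounds twice the distance over which a box can have been
     carried beyond t + 10 since [P]: the miles walked there plus the net
     progress made there. *)
  side_carry : forall t, 0 <= t ->
    2 * stock (fun y => pospart (y - t - 10)) n x b <=
    2 * \sum_(y <- h) tent (y - t) + tent (P - t) + pospart (m + x - (t + 10) - `|t + 10 - P|);
  (* The previous inequality at the time of the last opening. *)
  side_supply : forall t, 0 <= t ->
    0 <= 2 * \sum_(y <- h) tent (y - t) + tent (P - t);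
  (* In the interval from 0 to [c] the last way out is walked only once, and each
     mile of the way beyond [c] counts once. *)
  side_miles : forall c, 0 <= c ->
    2 * \sum_(y <- P :: h) capdist c y + 2 * stock (capdist c) n x b +
    (x - 2 * pospart (Num.min x c))
    <= 20 * (size h)%:R + m;
  (* The day in which a box comes to distance [d], unless it is the present one. *)
  side_far : forall d, 0 < d -> 1 <= stock (fun y => (d <= y)%R%:R) n x b ->
    founded d (P :: h) \/ 2 * d <= m + P + x;
  side_top : toured top (P :: h) \/ 2 * top <= m + P + x
}.

(** A walk of [d] miles outwards raises the bound by 2 d before the positive part is
    taken, and a walk back leaves it unchanged; when z is reached, the bound is no
    longer negative, because the way from [P] to z has been walked. *)
Lemma tent_walk n m P x d z : (n <= 1)%N -> `|x - P| <= m ->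
  2 * (n%:R * (pospart (x + d - z) - pospart (x - z))) + pospart (m + x - z - `|z - P|) <=
  pospart (m + `|d| + (x + d) - z - `|z - P|).
Proof.
move=> n1 xP; have far : `|z - P| <= `|z - x| + m.
  have -> : z - P = (z - x) + (x - P) by lra.
  by apply: le_trans (ler_normD _ _) _; rewrite lerD2l.
move: `|z - P| far => v far; have := pospart_ge0 (m + `|d| + (x + d) - z - v).
have : m + `|d| + (x + d) - z - v <= pospart (m + `|d| + (x + d) - z - v) by case: pospartP.
move: (pospart (m + `|d| + _ - _ - _)) => N N1 N0.
case: n n1 => [|[|//]] _; rewrite ?mul0r ?mul1r.
  by clear far; case: (ler0P d) N1 => ?; case: pospartP => *; lra.
case: (ler0P d) N1 => ? N1; case: (ler0P (z - x)) far => ? far.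
all: case: (pospartP (x - z)) => ?; case: (pospartP (x + d - z)) => ?; case: pospartP => ?; lra.
Qed.

Lemma miles_walk n x d c : (n <= 1)%N -> 0 <= c ->
  2 * (n%:R * (capdist c (x + d) - capdist c x)) + ((x + d) - 2 * pospart (Num.min (x + d) c))
  <= (x - 2 * pospart (Num.min x c)) + `|d|.
Proof.
rewrite /capdist => n1 c0.
case: n n1 => [|[|//]] _; rewrite ?mul0r ?mul1r; case: (ler0P d) => ?;
  case: (leP x c) => ?; case: (leP (x + d) c) => ?;
  rewrite ?(pospart_id c0);
  repeat (case: pospartP => ?); lra.
Qed.

Lemma side_walk h P m top n x b d : (n <= 1)%N -> m + `|d| <= 20 ->
  side h P m top n x b -> side h P (m + `|d|) (Num.max top (x + d)) n (x + d) b.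
Proof.
move=> n1 md [Hs Hm Hp Ht Ha Hc Hf Htop].
have st : `|x + d - P| <= m + `|d|.
  have -> : x + d - P = (x - P) + d by lra.
  by apply: le_trans (ler_normD _ _) _; rewrite lerD2r.
have stP : x + d - P <= m + `|d| by apply: le_trans st; exact: ler_norm.
have dd : - d <= `|d| by rewrite -normrN ler_norm.
split => //.
- move=> t t0; rewrite (@stock_walk (fun y => pospart (y - t - 10))).
  have := Ht t t0; have := @tent_walk n m P x d (t + 10) n1 Hs.
  have e y : y - t - 10 = y - (t + 10) by lra.
  rewrite !e; lra.
- move=> c c0; rewrite (@stock_walk (capdist c)).
  have := Hc c c0; have := @miles_walk n x d c n1 c0; lra.
- move=> e e0; rewrite (@stock_walk (fun y => (e <= y)%R%:R)).
  case: (leP e (x + d)) => ex.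
    by move=> _; right; lra.
  move=> B1; have : 1 <= stock (fun y => (e <= y)%R%:R) n x b.
    apply: le_trans B1 _; rewrite gerDl mulr_ge0_le0 ?ler0n // sub0r oppr_le0 ler0n //.
  by move=> /(Hf _ e0)[]; [left|right; lra].
- case: (leP top (x + d)) => tx; first by right; lra.
  by case: Htop; [left|right; lra].
Qed.

(** Dropping a box, taking one that lies here, and taking one at the base, where
    boxes weigh nothing. *)
Lemma side_rearrange h P m top n n' x b b' :
  (forall f, f 0 = 0 -> stock f n x b = stock f n' x b') ->
  side h P m top n x b -> side h P m top n' x b'.
Proof.
move=> E [Hs Hm Hp Ht Ha Hc Hf Htop]; split => //.
- by move=> t t0; rewrite -E ?Ht // pospart_nonpos //; lra.
- move=> c c0; rewrite -E ?Hc // /capdist oppr0 (pospart_id (lexx _)) addr0.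
  by rewrite (min_idPl c0) pospart_id.
- by move=> e e0; rewrite -E; [exact: Hf|rewrite leNgt e0].
Qed.

(** The balance of a full day from [P] to [x]. *)
Lemma day_tent P x t : 0 <= t -> `|x - P| <= 20 ->
  pospart (20 + x - (t + 10) - `|t + 10 - P|) <= tent (P - t) + pospart (x - t).
Proof.
rewrite /tent => t0; case: (ler0P (x - P)) => ?; case: (ler0P (t + 10 - P)) => ? ?;
  repeat (case: pospartP => ?); lra.
Qed.

(** By [day_tent] the day that ends at [x] earns [pospart (x - t)] for its end, and the
    box opened there leaves the store with twice its weight [pospart (x - t - 10)]: the
    difference is a tent. *)
Lemma side_open h P top n n' x b b' :
  (forall f, f 0 = 0 -> stock f n x b = stock f n' x b' + f x) ->
  side h P 20 top n x b -> side (P :: h) x 0 top n' x b'.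
Proof.
move=> E [Hs Hm Hp Ht Ha Hc Hf Htop].
have T t : 0 <= t -> 2 * stock (fun y => pospart (y - t - 10)) n' x b' <=
    2 * \sum_(y <- P :: h) tent (y - t) + tent (x - t).
  move=> t0; have := Ht t t0; rewrite E; last by rewrite pospart_nonpos //; lra.
  have := day_tent t0 Hs; rewrite big_cons [tent (x - t)]/tent; lra.
split => //.
- by rewrite subrr normr0.
- by rewrite lter_norml in Hs; lra.
- by move=> t t0; apply: le_trans (T t t0) _; rewrite lerDl pospart_ge0.
- move=> t t0; apply: le_trans (T t t0); rewrite mulr_ge0 //.
  by apply: stock_ge0 => y; exact: pospart_ge0.
- move=> c c0; have := Hc c c0; rewrite E; last first.
    by rewrite /capdist oppr0 (pospart_id (lexx _)) addr0 (min_idPl c0) pospart_id.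
  by rewrite [\sum_(y <- x :: _) _]big_cons /= -natr1; lra.
- move=> d d0 B1.
  have B1' : 1 <= stock (fun y => (d <= y)%R%:R) n x b.
    rewrite E; last by rewrite leNgt d0.
    by apply: le_trans B1 _; rewrite lerDl ler0n.
  case: (Hf d d0 B1') => [[h1 [pb [pa [h2 [-> V K]]]]]|V]; left.
    by exists (x :: h1), pb, pa, h2.
  exists [::], x, P, h; split => // [|t t0]; first lra.
  apply: le_trans (T t t0); rewrite ler_pM2l ?ltr0n //.
  case: (leP (d - 10 - t) 0) => dt.
    by apply: le_trans dt _; apply: stock_ge0 => y; exact: pospart_ge0.
  apply: (@le_trans _ _ ((d - 10 - t) * stock (fun y => (d <= y)%R%:R) n' x b')).
    by rewrite ler_peMr // ltW.
  rewrite -stock_scale; apply: stock_le => y; case: (leP d y) => dy.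
    by rewrite mulr1; case: pospartP => ?; lra.
  by rewrite mulr0 pospart_ge0.
- case: Htop => [[h1 [pb [pa [h2 [-> V]]]]]|V]; left.
    by exists (x :: h1), pb, pa, h2.
  by exists [::], x, P, h; split => //; lra.
Qed.

(** * From the circle to the line *)

Lemma same_pointP x y : reflect (exists k : int, x = y + 100 * k%:~R) (same_point x y).
Proof.
apply: (iffP idP) => [/intrP[k E]|[k ->]]; [exists k|]; first lra.
apply/intrP; exists k; lra.
Qed.

Lemma at_baseP x : reflect (exists k : int, x = 100 * k%:~R) (at_base x).
Proof.
by apply: (iffP (same_pointP _ _)) => -[k E]; exists k; rewrite E ?add0r.
Qed.

Definition near_base d x := exists k : int, `|x - 100 * k%:~R| < d.

Lemma near_base_le c d x : c <= d -> near_base c x -> near_base d x.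
Proof. by move=> cd [k K]; exists k; exact: lt_le_trans cd. Qed.

Lemma near_base_same d x y : same_point y x -> near_base d y -> near_base d x.
Proof.
move=> /same_pointP[j ->] [k K]; exists (k - j).
by congr (`|_| < d): K; rewrite rmorphB /=; lra.
Qed.

Lemma at_base_near d x : 0 < d -> at_base x -> near_base d x.
Proof. by move=> d0 /at_baseP[k ->]; exists k; rewrite subrr normr0. Qed.

Definition far d x : bool := ~~ `[< near_base d x >].

Lemma count_rem_mem (a : pred R) y b : y \in b -> count a b = (a y + count a (rem y b))%N.
Proof. by move=> /perm_to_rem/seq.permP->. Qed.

(** A box that lies within [d] of the base is of no use to somebody farther away.  So
    before he is within [d] of the base, the Professor can walk only on the box in use,
    on those he carries and on those that lie outside. *)
Lemma survival d s w u : 0 < d -> run s w u -> at_base (pos u) -> 0 <= food s ->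
  near_base (d + food s + 20 * (sealed s + count (far d) (lying s))%:R) (pos s).
Proof.
move=> d0; elim => {s w u} [s|s t u a w st _ IH] ub f0.
  by apply: near_base_le (at_base_near d0 ub); rewrite -addrA lerDl addr_ge0 ?mulr_ge0.
have triv j : near_base d (pos s) -> near_base (d + food s + 20 * j%:R) (pos s).
  by apply: near_base_le; rewrite -addrA lerDl addr_ge0 ?mulr_ge0.
case: st IH f0 triv => /=.
- move=> x f n b e ef /(_ ub) IH f0 _.
  have /IH[k K] : 0 <= f - `|e| by rewrite subr_ge0.
  exists k; have -> : x - 100 * k%:~R = (x + e - 100 * k%:~R) - e by lra.
  by apply: le_lt_trans (ler_normB _ _) _; lra.
- move=> x f n b /(_ ub) IH f0 /(_ _) triv.
  case: (pselect (near_base d x)) => [/triv //|nx].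
  apply: near_base_le (IH f0); rewrite /= lerD2l ler_pM2l ?ltr0n // ler_nat.
  by rewrite addSn -addnS leq_add2l (leq_add2r _ _ 1) leq_b1.
- move=> x f n b b' _ tk /(_ ub) IH f0 /(_ _) triv.
  case: (pselect (near_base d x)) => [/triv //|nx].
  case: tk IH => [[/(at_base_near d0) //]|[y [yb yx ->]] IH].
  apply: near_base_le (IH f0); rewrite lerD2l ler_pM2l ?ltr0n // ler_nat.
  rewrite (count_rem_mem _ yb) /far; case: asboolP => [/(near_base_same yx) //|_].
  by rewrite addSn -addnS.
- move=> x n b /(_ ub) IH f0 _.
  apply: near_base_le (IH _); last by [].
  by rewrite addSn -natr1; lra.
- move=> x n b b' tk /(_ ub) IH f0 /(_ _) triv.
  case: (pselect (near_base d x)) => [/triv //|nx].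
  case: tk IH => [[/(at_base_near d0) //]|[y [yb yx ->]] IH].
  apply: near_base_le (IH _); last by [].
  rewrite (count_rem_mem _ yb) /far; case: asboolP => [/(near_base_same yx) //|_].
  by rewrite addnS -natr1; lra.
Qed.

Lemma miles_cons a w : miles (a :: w) = (if a is Walk d then `|d| else 0) + miles w.
Proof. by rewrite /miles big_cons. Qed.

Lemma miles_ge0 w : 0 <= miles w.
Proof. by apply: sumr_ge0 => -[d|||] _. Qed.

Lemma miles_home s w u : run s w u -> at_base (pos u) ->
  exists k : int, `|pos s - 100 * k%:~R| <= miles w.
Proof.
elim => {s w u} [s|s t u a w st _ IH] ub.
  by case/at_baseP: ub => k ->; exists k; rewrite subrr normr0 miles_ge0.
have [k K] := IH ub; exists k; move: K; rewrite miles_cons.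
case: st => /= [x f n b d df|x f n b|x f n b b' _ _|x n b|x n b b' _] K; rewrite ?add0r //.
have -> : x - 100 * k%:~R = (x + d - 100 * k%:~R) - d by lra.
by apply: le_trans (ler_normB _ _) _; lra.
Qed.

Lemma count_sum (a : pred R) (f : R -> R) c l :
  (forall y, 0 <= f y) -> (forall y, a y -> c <= f y) ->
  c * (count a l)%:R <= \sum_(y <- l) f y.
Proof.
move=> f0 fc; elim: l => [|y l IH]; first by rewrite big_nil mulr0.
rewrite big_cons /= natrD mulrDr; apply: lerD => //.
by case: (boolP (a y)) => [/fc|_]; rewrite ?mulr1 ?mulr0.
Qed.

(** The circle reflected at the base; this gives the accounts of the negative side. *)
Definition mirror s := State (- pos s) (food s) (sealed s) (map -%R (lying s)).

Definition mirror_action (a : action R) : action R := if a is Walk d then Walk (- d) else a.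

Lemma same_pointN x y : same_point (- x) (- y) = same_point x y.
Proof. by rewrite /same_point -opprD mulNr rpredN. Qed.

Lemma at_baseN x : at_base (- x) = at_base x.
Proof. by rewrite /at_base -{1}oppr0 same_pointN. Qed.

Lemma take_lyingN x b b' : take_lying x b b' -> take_lying (- x) (map -%R b) (map -%R b').
Proof.
case=> [[xb ->]|[y [yb yx ->]]]; [left|right]; first by rewrite at_baseN.
exists (- y); rewrite same_pointN yx map_f // map_rem_inj //; exact: oppr_inj.
Qed.

Lemma run_mirror s w u : run s w u -> run (mirror s) (map mirror_action w) (mirror u).
Proof.
elim => {s w u} [s|s t u a w st _ IH]; first exact: run_nil.
apply: run_cons IH; case: st => /=.
- by move=> x f n b d df; rewrite /mirror /= opprD -[in f - _](normrN d); apply: step_walk; rewrite normrN.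
- by move=> x f n b; apply: step_drop.
- by move=> x f n b b' n1 /take_lyingN tk; apply: step_pickup.
- by move=> x n b; apply: step_unseal_carried.
- by move=> x n b b' /take_lyingN tk; apply: step_unseal_lying.
Qed.

Lemma miles_mirror w : miles (map mirror_action w) = miles w.
Proof.
by elim: w => [|a w IH] //=; rewrite !miles_cons IH; case: a => //= d; rewrite normrN.
Qed.

(** * Coming round *)

Lemma capdist_ge0 c y : 0 <= capdist c y.
Proof. by rewrite addr_ge0 ?pospart_ge0. Qed.

Lemma stock_mem (f : R -> R) n x b y : (forall z, 0 <= f z) -> y \in b -> f y <= stock f n x b.
Proof.
move=> f0 yb; rewrite /stock (big_rem y yb) /= addrCA lerDl addr_ge0 ?mulr_ge0 ?ler0n //.
by apply: sumr_ge0 => z _.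
Qed.

Lemma step_lower x P m : `|x - P| <= m -> x - m <= P.
Proof. by rewrite ler_norml; lra. Qed.

(** On the positive side, the Professor finds at [x] a box that was left there from the
    negative side, at distance 100 - x from the base. *)
Record meeting h (P m top bot : R) n x b : Prop := Meeting {
  meeting_right : side h P m top n x b;
  meeting_left : side (map -%R h) (- P) m bot n (- x) (map -%R b);
  meeting_pos : 0 < x < 100;
  meeting_depot : x - 100 \in b
}.

Lemma meeting_day h P m top bot n x b : meeting h P m top bot n x b ->
  [/\ x - m <= P, m <= 20, 0 < x & x < 100].
Proof.
move=> [r _ /andP[x0 x1] _]; split => //; [exact: step_lower (side_step r)|exact: side_day r].
Qed.

Lemma mirror_depot x b : x - 100 \in b -> 100 - x \in map -%R b.
Proof. by move=> xb; rewrite -[100 - x]opprK map_f // opprB. Qed.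

(** The depot cannot have been founded on the present day, which would have to lead
    from there to [x] through 100 miles. *)
Lemma depot_founded h P m top bot n x b : meeting h P m top bot n x b ->
  founded (100 - x) (- P :: map -%R h).
Proof.
move=> M; have [P_ge m_le x_gt0 x_lt100] := meeting_day M; case: M => right left _ depot.
have [] := side_far left (_ : 0 < 100 - x) => //; first by rewrite subr_gt0.
  have := @stock_mem (fun y => (100 - x <= y)%R%:R) n (- x) _ _
    (fun y => ler0n _ _) (mirror_depot depot).
  by rewrite lexx.
by move=> V; exfalso; clear -P_ge m_le x_gt0 V; lra.
Qed.

(** The account of the ground more than 10 miles from the base on the negative side;
    the present day has no share in it unless [x] is below 10. *)
Lemma depot_tents h P m top bot n x b : meeting h P m top bot n x b ->
  90 - x - pospart (10 - x) <= \sum_(y <- - P :: map -%R h) tent y.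
Proof.
move=> M; have [P_ge m_le x_gt0 x_lt100] := meeting_day M; case: M => right left _ depot.
have := side_carry left (lexx 0).
have -> : \sum_(y <- map -%R h) tent (y - 0) = \sum_(y <- map -%R h) tent y.
  by apply: eq_bigr => y _; rewrite subr0.
have B : 90 - x <= stock (fun y => pospart (y - 0 - 10)) n (- x) (map -%R b).
  apply: (le_trans _ (stock_mem _ _ (fun=> pospart_ge0 _) (mirror_depot depot))).
  by clear; case: pospartP => ?; lra.
have tP : 0 <= tent (- P).
  by clear -P_ge m_le x_gt0; rewrite /tent; case: pospartP => ?; case: pospartP => ?; lra.
have H1 : pospart (m + - x - (0 + 10) - `|0 + 10 - - P|) <= 2 * pospart (10 - x).
  have : 10 + P <= `|0 + 10 - - P| by rewrite add0r opprK ler_norm.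
  by clear -P_ge m_le; case: pospartP => ?; case: pospartP => ?; lra.
rewrite subr0 big_cons => T; clear -B tP H1 T.
by move: (\sum_(y <- _) _) (stock _ _ _ _) (pospart (10 - x)) (pospart _) (tent _) T B tP H1 => *; lra.
Qed.

(** With d = 100 - x, this is 5 d - 90 as soon as [x] is at least 10. *)
Lemma depot_cost h P m top bot n x b : meeting h P m top bot n x b ->
  410 - 5 * x - pospart (10 - x) <= \sum_(y <- - P :: map -%R h) pospart y.
Proof.
move=> M; have := toured_sum (founded_toured (depot_founded M)); have := depot_tents M.
by move: (\sum_(y <- _) _) (\sum_(y <- _) _) (pospart _) => *; lra.
Qed.

(** Founding a depot 50 miles or more from the base takes too long, by the account of
    the miles on the negative side, that is, for c = 0. *)
Lemma depot_close h P m top bot n x b : meeting h P m top bot n x b ->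
  20 * (size h)%:R + m < 465 -> 50 < x.
Proof.
move=> M; have := depot_cost M; have [_ _ x_gt0 _] := meeting_day M.
case: M => right _ _ depot; have := side_miles right (lexx 0).
have E y : capdist 0 y = pospart (- y).
  by rewrite /capdist [X in X + _]pospart_nonpos ?add0r // ge_min lexx orbT.
have -> : \sum_(y <- P :: h) capdist 0 y = \sum_(y <- - P :: map -%R h) pospart y.
  by rewrite !big_cons big_map E; congr (_ + _); apply: eq_bigr => y _.
have -> : pospart (Num.min x 0) = 0 by rewrite pospart_nonpos // ge_min lexx orbT.
have B : 100 - x <= stock (capdist 0) n x b.
  apply: (le_trans _ (stock_mem _ _ (capdist_ge0 0) depot)).
  by rewrite E opprB; case: pospartP.
clear -B x_gt0; move: (\sum_(y <- _) _) (stock _ _ _ _) B => S B Bx.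
by case: (pospartP (10 - x)) => *; lra.
Qed.

Lemma dist_home x k : 50 < x -> 100 - x <= `|x - 100 * k%:~R|.
Proof.
move=> x_gt50; case: (lerP k 0) => k0.
  have k1 : k%:~R <= 0 :> R by rewrite lerz0.
  by apply: le_trans (ler_norm _); clear -k1 x_gt50; lra.
have k1 : 1 <= k%:~R :> R by rewrite ler1z -gtz0_ge1.
by rewrite distrC; apply: le_trans (ler_norm _); clear -k1 x_gt50; lra.
Qed.

(** A box within 60 - P of the base would be reached too late: the rest of the box in use
    and the twenty miles of the box at the depot do not suffice to come that close. *)
Lemma spare_box h P m top bot n x b : meeting h P m top bot n x b ->
  50 < x ->
  (forall d, 0 < d -> near_base (d + (20 - m) + 20 * (n + count (far d) b)%:R) x) ->
  100 - x + pospart (60 - P) <= stock (capdist P) n x b.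
Proof.
move=> M; have [P_ge m_le x_gt0 x_lt100] := meeting_day M; case: M => right left _ depot.
move=> x_gt50 surv; have P30 : 30 < P by clear -P_ge m_le x_gt50; lra.
rewrite /stock (big_rem _ depot) /= addrCA; apply: lerD.
  by rewrite /capdist opprB; have := pospart_ge0 (Num.min (x - 100) P); clear; case: (pospartP (100 - x)) => ? ?; lra.
case: (pospartP (60 - P)) => [P60|_]; last first.
  by rewrite addr_ge0 ?mulr_ge0 ?capdist_ge0 //; apply: sumr_ge0 => y _; exact: capdist_ge0.
case: (ltrgt0P (60 - P)) P60 => // [P60|->] _; last first.
  by rewrite addr_ge0 ?mulr_ge0 ?capdist_ge0 //; apply: sumr_ge0 => y _; exact: capdist_ge0.
have [j] := surv _ P60; rewrite (count_rem_mem _ depot).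
have := dist_home j x_gt50; set K := count _ (rem _ _) => dj jN.
have J : (1 <= n + K)%N.
  rewrite lt0n addn_eq0; apply/negP => /andP[/eqP n0 /eqP K0].
  have : (n + (far (60 - P) (x - 100)%R + K))%:R <= 1 :> R.
    by rewrite n0 K0 addn0 add0n (ler_nat _ _ 1) leq_b1.
  by clear -P_ge dj jN; lra.
have KS : (60 - P) * K%:R <= \sum_(y <- rem (x - 100) b) capdist P y.
  apply: count_sum => [|y]; first exact: capdist_ge0.
  rewrite /far => /asboolPn nf; have : 60 - P <= `|y|.
    by rewrite leNgt; apply/negP => yn; apply: nf; exists 0; rewrite mulr0 subr0.
  by clear -P30; rewrite /capdist; case: (ler0P y) => ?; case: (leP y P) => ?;
    case: pospartP => ?; case: pospartP => ?; lra.
have xS : 60 - P <= capdist P x.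
  by clear -P30 x_gt50; rewrite /capdist; case: (leP x P) => ?; case: pospartP => ?; case: pospartP => ?; lra.
apply: (@le_trans _ _ ((60 - P) * (n + K)%:R)).
  by rewrite ler_peMr ?(ler_nat _ 1) // ltW.
by rewrite natrD mulrDr; apply: lerD KS; rewrite mulrC ler_wpM2l.
Qed.

(** The account of the miles is used with the cap at the last opening [P]: beyond it the
    present day has brought no box that counts. *)
Lemma meeting_bound T h P m top bot n x b : meeting h P m top bot n x b ->
  50 < x ->
  (forall d, 0 < d -> near_base (d + (20 - m) + 20 * (n + count (far d) b)%:R) x) ->
  20 * (size h)%:R + m + (100 - x) <= T -> 460 + 125 / 29 <= T.
Proof.
move=> M x_gt50 surv; have [P_ge m_le x_gt0 x_lt100] := meeting_day M.
have B3 := spare_box M x_gt50 surv; have cost := depot_cost M; have FH := depot_founded M.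
case: M => right left _ depot TT.
have P30 : 30 < P by clear -P_ge m_le x_gt50; lra.
have LN : \sum_(y <- - P :: map -%R h) pospart y = \sum_(y <- h) pospart (- y).
  by rewrite big_cons big_map pospart_nonpos ?add0r //; clear -P30; lra.
have P0 : 0 <= P by clear -P30; lra.
apply: (@total_from_costs P (100 - x) (pospart (60 - P)) _ h).
- exact: ltW.
- by clear -P_ge m_le; lra.
- exact: pospart_ge0.
- by case: pospartP.
- exact: side_prev right.
- exact: side_supply right.
- by rewrite subr_ge0 ltW.
- rewrite -LN; apply: le_trans cost.
  by rewrite (pospart_nonpos (x := 10 - x)); clear -x_gt50; lra.
- by move=> d20 d28; rewrite -LN; exact: founded_sum FH d20 d28.
- have := side_miles right P0; rewrite big_cons.
  have p1 : P <= capdist P P by rewrite /capdist minxx [pospart P]pospart_id // lerDl pospart_ge0.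
  have p2 : 2 * pospart (Num.min x P) <= 2 * P.
    by clear -P0; case: (leP x P) => ?; case: pospartP => ?; lra.
  clear -p1 p2 B3 m_le; move: (pospart (60 - P)) (stock _ _ _ _) B3 p1 p2 => *; lra.
- by clear -P_ge TT; lra.
Qed.

(** The walk so far takes place on the line: it stays between -100 and 100, and boxes
    are taken only at 0 and where the walk has left them. *)
Record on_line h (P top bot : R) s : Prop := OnLine {
  inv_right : side h P (20 - food s) top (sealed s) (pos s) (lying s);
  inv_left : side (map -%R h) (- P) (20 - food s) bot (sealed s) (- pos s) (map -%R (lying s));
  inv_sealed : (sealed s <= 1)%N;
  inv_food : 0 <= food s;
  inv_range : - bot <= pos s <= top;
  inv_pos : `|pos s| < 100;
  inv_lying : forall y, y \in lying s -> `|y| < 100;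
  inv_hist : forall y, y \in P :: h -> `|y| < 100
}.

Lemma on_line_mirror h P top bot s :
  on_line h P top bot s -> on_line (map -%R h) (- P) bot top (mirror s).
Proof.
move=> [Hr Hl Hn Hf Hb Hx Hy Hh]; split => //=.
- by rewrite !opprK -!map_comp !(@eq_map _ _ (-%R \o -%R) id) ?map_id //; exact: opprK.
- by lra.
- by rewrite normrN.
- by move=> y /mapP[z /Hy zb ->]; rewrite normrN.
- by move=> y; rewrite -(map_cons -%R P h) => /mapP[z /Hh zb ->]; rewrite normrN.
Qed.

Lemma cross_bound h P top bot s w u : on_line h P top bot s -> run s w u ->
  at_base (pos u) -> 0 < pos s -> pos s - 100 \in lying s ->
  460 + 125 / 29 <= 20 * (size h)%:R + (20 - food s) + miles w.
Proof.
move=> L rw ub x0 xb.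
have M : meeting h P (20 - food s) top bot (sealed s) (pos s) (lying s).
  case: L => r l _ _ _ x100 _ _; split => //; rewrite x0 /=.
  by apply: le_lt_trans x100; exact: ler_norm.
have mw := miles_ge0 w.
case: (ltP (20 * (size h)%:R + (20 - food s)) 465) => [short|]; last lra.
have x50 := depot_close M short; apply: (meeting_bound M x50) => [d d0|].
  rewrite (_ : 20 - (20 - food s) = food s); last lra.
  exact: survival d0 rw ub (inv_food L).
have [k] := miles_home rw ub; have := dist_home k x50; lra.
Qed.

(** Reaching 100 means coming round without any depot: d = 0, and the last opening is
    at 80 or beyond. *)
Lemma wall_bound h P top bot s e : on_line h P top bot s ->
  `|e| <= food s -> 100 <= pos s + e ->
  460 + 125 / 29 <= 20 * (size h)%:R + (20 - food s) + `|e|.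
Proof.
move=> [Hr _ _ _ _ _ _ _]; case: s Hr => x f n b /= Hr ef xe.
set m := 20 - f in Hr *.
have hop := step_lower (side_step Hr); have m20 := side_day Hr.
have ee := ler_norm e.
have P80 : 80 <= P by rewrite /m in hop; lra.
have P0 : 0 <= P by lra.
have B0 : 0 <= stock (capdist P) n x b.
  by apply: stock_ge0 => y; rewrite addr_ge0 ?pospart_ge0.
have M := side_miles Hr P0.
have xP : x <= 2 * capdist P P + (x - 2 * pospart (Num.min x P)).
  rewrite /capdist minxx [pospart P]pospart_id // [pospart (- P)]pospart_nonpos; last lra.
  clear -P0; case: (leP x P) => ?; case: pospartP => ?; lra.
have mx : 80 + m <= x by rewrite /m; clear -ee ef xe; lra.
rewrite big_cons in M.
apply: (@total_from_costs P 0 0 _ h) => //.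
- by clear -P80; lra.
- by clear -P80; lra.
- by clear -P80; lra.
- exact: side_prev Hr.
- exact: side_supply Hr.
- have : 0 <= \sum_(y <- h) pospart (- y) by exact: sumr_ge0 (fun y _ => pospart_ge0 _).
  by move: (\sum_(y <- h) _) => S; clear; lra.
- by move=> d20; exfalso; clear -d20; lra.
- by clear -M B0 xP mx; lra.
- by clear -hop ee xe; lra.
Qed.

(** Without a box left there, the farthest point visited has still cost the two openings
    of the day of the visit. *)
Lemma side_reach h P m top n b : side h P m top n 0 b ->
  4 * top - 80 <= \sum_(y <- P :: h) pospart y.
Proof.
move=> H; have hop := side_step H; have m20 := side_day H.
have P20 : P <= 20 by rewrite sub0r normrN in hop; have := ler_norm P; lra.
have tP : 0 <= tent P.
  by rewrite /tent; case: pospartP => ?; case: pospartP => ?; lra.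
have T0 : 0 <= \sum_(y <- h) tent y + tent P.
  have := side_supply H (lexx _); rewrite subr0.
  have -> : \sum_(y <- h) tent (y - 0) = \sum_(y <- h) tent y.
    by apply: eq_bigr => y _; rewrite subr0.
  by move: (\sum_(y <- h) _) => S; lra.
case: (side_top H) => [/toured_sum|V].
  by rewrite !big_cons; move: (\sum_(y <- h) _) (\sum_(y <- h) _) T0 => S S' ; lra.
have D : \sum_(y <- h) tent y <= \sum_(y <- h) pospart y.
  by apply: ler_sum => y _; exact: tent_le_pospart.
rewrite big_cons; move: D T0; move: (\sum_(y <- h) _) (\sum_(y <- h) _) => S S'.
by rewrite /tent; case: (pospartP P) => ?; case: pospartP => ?; lra.
Qed.

(** If the walk stays on the line and ends at the base, the distances reached on the two
    sides add up to 100, and each distance d costs openings of sum 4 d - 80, twice the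
    miles of which have to be walked: 480 in all. *)
Lemma return_bound h P top bot s : on_line h P top bot s -> at_base (pos s) ->
  (forall y, exists2 z, - bot <= z <= top & same_point z y) ->
  460 + 125 / 29 <= 20 * (size h)%:R + (20 - food s).
Proof.
move=> [Hr Hl _ _ rg px _ hb] ub vis.
have x0 : pos s = 0.
  case/at_baseP: ub px => -[[|k]|k] ->; first by rewrite mulr0.
    have : 1 <= (Posz k.+1)%:~R :> R by rewrite ler1n.
    by rewrite ltr_norml; lra.
  have : (Negz k)%:~R <= -1 :> R by rewrite NegzE mulrNz lerN2 ler1n.
  by rewrite ltr_norml; lra.
rewrite x0 in Hr Hl rg; rewrite oppr0 in Hl.
have wide : 100 <= top + bot.
  rewrite leNgt; apply/negP => narrow.
  have [z /andP[z1 z2] /same_pointP[k E]] := vis ((top + (100 - bot)) / 2).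
  case: k E => k E.
    have : 0 <= (Posz k)%:~R :> R by rewrite ler0n.
    lra.
  have : (Negz k)%:~R <= -1 :> R by rewrite NegzE mulrNz lerN2 ler1n.
  lra.
have Sr := side_reach Hr.
have Sl : 4 * bot - 80 <= \sum_(y <- P :: h) pospart (- y).
  by rewrite -(big_map -%R xpredT pospart); exact: side_reach Hl.
have := side_miles Hr (_ : 0 <= 100).
have B0 : 0 <= stock (capdist 100) (sealed s) 0 (lying s).
  by apply: stock_ge0 => y; rewrite addr_ge0 ?pospart_ge0.
have -> : \sum_(y <- P :: h) capdist 100 y = \sum_(y <- P :: h) pospart y + \sum_(y <- P :: h) pospart (- y).
  rewrite -big_split /= !big_seq; apply: eq_bigr => y /hb yb.
  by rewrite /capdist (min_idPl _) // ltW //; apply: le_lt_trans yb; exact: ler_norm.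
move: Sr Sl B0; move: (\sum_(y <- P :: h) pospart y) (\sum_(y <- P :: h) pospart (- y)) (stock _ _ _ _) => S S' B.
rewrite (min_idPl _) // pospart_nonpos // => Sr Sl B0 /(_ (ler0n _ 100)) M.
clear -Sr Sl B0 M wide; lra.
Qed.

(** * The lower bound *)

Lemma on_line_rearrange h P top bot x f n n' b b' :
  (forall F : R -> R, F 0 = 0 -> stock F n x b = stock F n' x b') ->
  (n' <= 1)%N -> (forall y, y \in b' -> `|y| < 100) ->
  on_line h P top bot (State x f n b) -> on_line h P top bot (State x f n' b').
Proof.
move=> E n1 hb' [Hr Hl Hn Hf Hg Hx Hb Hh]; split => //=.
  exact: side_rearrange Hr.
apply: side_rearrange Hl => F F0.
have := E (F \o -%R); rewrite /stock !big_map /= oppr0 => -> //.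
Qed.

Lemma on_line_open h P top bot x n n' b b' :
  (forall F : R -> R, F 0 = 0 -> stock F n x b = stock F n' x b' + F x) ->
  (n' <= 1)%N -> (forall y, y \in b' -> `|y| < 100) ->
  on_line h P top bot (State x 0 n b) -> on_line (P :: h) x top bot (State x 20 n' b').
Proof.
move=> E n1 hb' [/= Hr Hl Hn Hf Hg Hx Hb Hh]; rewrite subr0 in Hr Hl; split => //=.
- by rewrite subrr; exact: side_open Hr.
- rewrite subrr; apply: side_open Hl => F F0.
  have := E (F \o -%R); rewrite /stock !big_map /= oppr0 => -> //.
- by move=> y; rewrite inE => /orP[/eqP->//|/Hh].
Qed.

Lemma on_line_walk h P top bot x f n b d : `|d| <= f -> `|x + d| < 100 ->
  on_line h P top bot (State x f n b) ->
  on_line h P (Num.max top (x + d)) (Num.max bot (- (x + d))) (State (x + d) (f - `|d|) n b).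
Proof.
move=> df xd [/= Hr Hl Hn Hf /andP[g1 g2] Hx Hb Hh].
have mE : 20 - (f - `|d|) = 20 - f + `|d| by lra.
have m20 : 20 - f + `|d| <= 20 by lra.
split => //=.
- by rewrite mE; exact: side_walk.
- by rewrite mE opprD -[`|d|]normrN; apply: side_walk; rewrite ?normrN.
- by rewrite subr_ge0.
- by rewrite lerNl !le_max !lexx !orbT.
Qed.

Lemma same_point_near x y : `|x| < 100 -> `|y| < 100 -> same_point y x ->
  [\/ y = x, y = x - 100 /\ 0 < x | y = x + 100 /\ x < 0].
Proof.
rewrite !ltr_norml => /andP[x1 x2] /andP[y1 y2] /same_pointP[[[|[|k]]|[|k]] E].
- by constructor 1; rewrite E mulr0 addr0.
- by constructor 3; rewrite mulr1 in E; split => //; lra.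
- have : 2 <= (Posz k.+2)%:~R :> R by rewrite (ler_nat _ 2).
  lra.
- by constructor 2; rewrite NegzE mulrN1z ?mulrN mulr1 in E; split => //; lra.
- have : (Negz k.+1)%:~R <= -2 :> R by rewrite NegzE mulrNz lerN2 (ler_nat _ 2).
  lra.
Qed.

Lemma at_base_near0 x : `|x| < 100 -> at_base x -> x = 0.
Proof.
move=> x1 xb; have z0 : `|0 : R| < 100 by rewrite normr0.
case: (same_point_near z0 x1 xb) => [//|[]|[]]; rewrite ltxx //.
Qed.

(** A box taken from the other side settles the bound; any other box is taken at 0 or
    where the walk has left it. *)
Lemma take_cases h P top bot s w u x b' : on_line h P top bot s -> run s w u ->
  at_base (pos u) -> take_lying (pos s) (lying s) b' ->
  460 + 125 / 29 <= 20 * (size h)%:R + (20 - food s) + miles w \/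
  ((forall F : R -> R, F 0 = 0 ->
      \sum_(y <- lying s) F y = \sum_(y <- b') F y + F (pos s)) /\
   (forall y, y \in b' -> `|y| < 100)).
Proof.
move=> LI rw ub; have px := inv_pos LI; have hb := inv_lying LI.
case=> [[/(at_base_near0 px) x0 ->]|[y [yb /(same_point_near px (hb y yb)) yx ->]]].
  by right; split => // F F0; rewrite x0 F0 addr0.
case: yx => [yx|[yx x0]|[yx x0]].
- right; split => [F _|z /mem_rem/hb //].
  by rewrite (big_rem y yb) /= yx addrC.
- by left; apply: (cross_bound LI rw ub x0); rewrite -yx.
- left; have LI' := on_line_mirror LI.
  have := @cross_bound _ _ _ _ _ _ _ LI' (run_mirror rw).
  rewrite size_map miles_mirror /= at_baseN; apply => //; first by rewrite oppr_gt0.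
  by rewrite -opprD -yx map_f.
Qed.

(** Induction on the rest of the walk, as long as it remains on the line; the interval
    from [- bot] to [top] holds the points already visited. *)
Lemma lower_bound s w u : run s w u -> at_base (pos u) ->
  forall h P top bot, on_line h P top bot s ->
  (forall y, (exists2 z, - bot <= z <= top & same_point z y) \/ visits (pos s) w y) ->
  460 + 125 / 29 <= 20 * (size h)%:R + (20 - food s) + miles w.
Proof.
elim => {s w u} [s|s t u a w st rt IH] ub h P top bot LI vis.
  rewrite /miles big_nil addr0; apply: (return_bound LI ub) => y.
  have rg := inv_range LI.
  by case: (vis y) => //= sp; exists (pos s).
have rw : run s (a :: w) u by apply: run_cons st rt.
have {}IH := IH ub.
case: st rw LI vis IH => /=.
- move=> x f n b d df rw LI vis IH; rewrite miles_cons.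
  case: (ltP `|x + d| 100) => xd; last first.
    have mw := miles_ge0 w.
    suff : 460 + 125 / 29 <= 20 * (size h)%:R + (20 - f) + `|d| by lra.
    move: xd; rewrite ler_normr => /orP[xd|xd]; first exact: wall_bound LI _ xd.
    have := @wall_bound _ _ _ _ _ (- d) (on_line_mirror LI).
    by rewrite size_map normrN /= -opprD; apply.
  have LI' := on_line_walk df xd LI.
  have := IH _ _ _ _ LI' _; rewrite /=.
  have -> : 20 * (size h)%:R + (20 - (f - `|d|)) + miles w =
            20 * (size h)%:R + (20 - f) + (`|d| + miles w) by lra.
  apply=> y; case: (vis y) => [[z zr zy]|[[e [/andP[e0 e1] ey]]|]].
  + by left; exists z => //; rewrite lerNl !le_max lerNl; case/andP: zr => -> ->.
  + left; exists (x + e * d) => //; have /= /andP[g1 g2] := inv_range LI.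
    apply/andP; case: (lerP 0 d) => d0.
      have ed0 : 0 <= e * d by apply: mulr_ge0.
      have ed1 : e * d <= d by rewrite ler_piMl.
      by rewrite lerNl !le_max; split; apply/orP; [left|right]; lra.
    have ed0 : e * d <= 0 by rewrite mulr_ge0_le0 // ltW.
    have ed1 : d <= e * d by rewrite -subr_le0 -{1}[d]mul1r -mulrBl mulr_ge0_le0 ?subr_ge0 // ltW.
    by rewrite lerNl !le_max; split; apply/orP; [right|left]; lra.
  + by right.
- move=> x f n b rw LI vis IH; rewrite miles_cons add0r.
  apply: IH vis; apply: (on_line_rearrange _ _ _ LI) => /=.
  + by move=> F _; rewrite /stock big_cons -natr1; lra.
  + by apply: ltnW (inv_sealed LI).
  + by move=> y; rewrite inE => /orP[/eqP->|/(inv_lying LI) //]; exact: (inv_pos LI).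
- move=> x f n b b' n1 tk rw LI vis IH.
  have [//|[S hb]] := take_cases x LI rw ub tk.
  rewrite miles_cons add0r; apply: IH vis; apply: (on_line_rearrange _ _ _ LI) => //=.
  + by move=> F F0; rewrite /stock S // -natr1; lra.
  + by move: n1; rewrite addn1 add1n !ltnS.
- move=> x n b rw LI vis IH; rewrite miles_cons add0r.
  have -> : 20 * (size h)%:R + (20 - 0) + miles w =
            20 * (size (P :: h))%:R + (20 - 20) + miles w by rewrite /= -natr1; lra.
  apply: (IH (P :: h) x top bot) vis; apply: (on_line_open _ _ _ LI) => /=.
  + by move=> F _; rewrite /stock -natr1; lra.
  + by apply: ltnW (inv_sealed LI).
  + exact: inv_lying LI.
- move=> x n b b' tk rw LI vis IH.
  have [//|[S hb]] := take_cases x LI rw ub tk.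
  rewrite miles_cons add0r.
  have -> : 20 * (size h)%:R + (20 - 0) + miles w =
            20 * (size (P :: h))%:R + (20 - 20) + miles w by rewrite /= -natr1; lra.
  apply: (IH (P :: h) x top bot) vis; apply: (on_line_open _ _ _ LI) => //=.
  + by move=> F F0; rewrite /stock S // addrA.
  + exact: inv_sealed LI.
Qed.

Lemma side_dawn : side [::] 0 0 0 0 (0 : R) [::].
Proof.
have B (F : R -> R) : stock F 0 0 [::] = 0 by rewrite /stock mul0r big_nil addr0.
split => //; rewrite ?subrr ?normr0 //.
- move=> t t0; rewrite B big_nil mulr0 add0r (tent_nonpos (x := 0 - t)) ?add0r ?pospart_ge0 //; lra.
- by move=> t t0; rewrite big_nil mulr0 add0r tent_nonpos //; lra.
- move=> c c0; rewrite B big_cons big_nil /capdist oppr0 (min_idPl c0) pospart_nonpos //=; lra.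
- by move=> d d0; rewrite B ler10.
- by right; lra.
Qed.

Lemma on_line_dawn : on_line [::] 0 0 0 (dawn R).
Proof.
split => //=; rewrite ?subrr ?oppr0 ?lexx ?normr0 //; try exact: side_dawn.
by move=> y; rewrite inE => /eqP->; rewrite normr0.
Qed.

Lemma dawn_bound w : exploration_from_dawn w -> 23 + 25 / 116 <= duration w.
Proof.
move=> [[u [rw ub]] vis].
have := lower_bound rw ub on_line_dawn (fun y => or_intror (vis y)).
by rewrite /duration /=; lra.
Qed.

End LowerBound.

(** * The schedule *)

(** The optimal walk has all its turning points on the grid of mesh 5/116 miles, where a
    day has 464 steps and the circle 2320.  The rules are executed there on integers, and
    [obey_run] transfers the execution to the reals. *)
Variant order := Go of int | Put | Take | Open.

Definition grid_state := (int * int * nat * seq int)%type.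

Definition fetch (x : int) (b : seq int) : option (seq int) :=
  if (2320 %| x)%Z then Some b
  else if [seq y <- b | (2320 %| y - x)%Z] is y :: _ then Some (rem y b) else None.

Definition obey (s : grid_state) (a : order) : option grid_state :=
  let: (x, f, n, b) := s in
  match a with
  | Go d => if `|d| <= f then Some (x + d, f - `|d|, n, b) else None
  | Put => if n is n'.+1 then Some (x, f, n', x :: b) else None
  | Take => if n is 0%N then omap (fun b' => (x, f, 1%N, b')) (fetch x b) else None
  | Open => if f != 0 then None else
      if n is n'.+1 then Some (x, 464, n', b)
      else omap (fun b' => (x, 464, 0%N, b')) (fetch x b)
  end.

Fixpoint obey_all (s : grid_state) (w : seq order) : option grid_state :=
  if w is a :: w' then obind (fun t => obey_all t w') (obey s a) else Some s.

Definition net (w : seq order) : int := foldr (fun a z => if a is Go d then d + z else z) 0 w.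
Definition effort (w : seq order) : int := foldr (fun a z => if a is Go d then `|d| + z else z) 0 w.

Definition haul (d : int) : seq order := [:: Take; Go d; Put].

Definition schedule : seq order :=
  (* A box to 216, to be opened there or taken on, and one to -16. *)
  let to_right := haul 216 ++ Go (- 216) :: haul (- 16) ++ [:: Go 16; Open] in
  (* A box to 232, which is 10 miles away: out and back in exactly one day. *)
  let base_right := haul 232 ++ [:: Go (- 232); Open] in
  to_right ++ to_right ++
  (* The negative side: a box to -72, two to -96, one to -232; then two to -256, one
     to -408 and the depot to -564, opening boxes at -96, -256 and -408; on the way
     back the box at -72 is moved to -100. *)
  haul (- 72) ++ Go 56 :: haul (- 80) ++ Go 80 :: haul (- 80) ++ [:: Go 96; Open] ++
  haul (- 232) ++ [:: Go 232; Open] ++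
  haul (- 256) ++ Go 24 :: haul (- 24) ++ [:: Go 160; Open] ++
  haul (- 312) ++ [:: Go 152; Open] ++
  haul (- 308) ++ [:: Go 156; Open] ++
  Go 336 :: haul (- 28) ++ [:: Go 100; Open] ++
  base_right ++ base_right ++ base_right ++ base_right ++ base_right ++
  (* The way out: days that end at 216, 232, 232, 286, 460, 548 and 828. *)
  haul 286 ++ Go (- 54) :: haul 54 ++ [:: Go (- 70); Open] ++
  haul 240 ++ [:: Go (- 224); Open] ++
  haul 228 ++ Go (- 4) :: haul 4 ++ [:: Go (- 228); Open] ++
  haul 259 ++ [:: Go (- 205); Open] ++
  haul 262 ++ Go (- 57) :: haul 57 ++ [:: Go (- 88); Open] ++
  haul 276 ++ [:: Go (- 188); Open] ++
  haul 280 ++ Go (- 92) :: haul 92 ++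
  (* Round the circle, on two boxes from 828, then those at 1756 and 2220. *)
  [:: Open; Take; Go 464; Open; Go 464; Open; Go 464; Open; Go 100].

Lemma schedule_runs : obey_all (0, 464, 0%N, [::]) schedule = Some (2320, 364, 0%N, [::]).
Proof. by vm_compute. Qed.

Section UpperBound.
Variable R : realType.

Definition scale (z : int) : R := z%:~R * (5 / 116).

Lemma scaleD y z : scale (y + z) = scale y + scale z.
Proof. by rewrite /scale rmorphD /= mulrDl. Qed.

Lemma scaleN z : scale (- z) = - scale z.
Proof. by rewrite /scale rmorphN /= mulNr. Qed.

Lemma scale_norm z : `|scale z| = scale `|z|.
Proof. by rewrite /scale normrM intr_norm [X in _ * X = _]ger0_norm //; lra. Qed.

Lemma scale_le y z : y <= z -> scale y <= scale z.
Proof. by move=> yz; rewrite /scale ler_pM2r ?ler_int //; lra. Qed.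

Lemma scale_inj : injective scale.
Proof.
have c0 : 5 / 116 != 0 :> R by rewrite mulf_neq0 ?invr_eq0 ?pnatr_eq0.
by move=> y z /(mulIf c0)/intr_inj.
Qed.

Lemma same_point_scale y x : (2320 %| y - x)%Z -> same_point (scale y) (scale x).
Proof.
move=> /dvdzP[q E]; apply/same_pointP; exists q.
by rewrite -[y](subrK x) E scaleD /scale rmorphM /=; lra.
Qed.

Definition to_action (a : order) : action R :=
  match a with Go d => Walk (scale d) | Put => Drop | Take => PickUp | Open => Unseal end.

Definition to_state (s : grid_state) : state R :=
  let: (x, f, n, b) := s in State (scale x) (scale f) n (map scale b).

Lemma fetch_take x b b' : fetch x b = Some b' ->
  take_lying (scale x) (map scale b) (map scale b').
Proof.
rewrite /fetch; case: ifP => [x0 [<-]|_].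
  left; split => //; rewrite /at_base.
  have -> : 0 = scale 0 by rewrite /scale mul0r.
  by apply: same_point_scale; rewrite subr0.
case E: (filter _ _) => [//|y l] [<-]; right; exists (scale y).
have : y \in [seq y <- b | (2320 %| y - x)%Z] by rewrite E mem_head.
rewrite mem_filter => /andP[yx yb].
by rewrite same_point_scale // map_f // map_rem_inj //; exact: scale_inj.
Qed.

Lemma obey_step s a t : obey s a = Some t -> step (to_state s) (to_action a) (to_state t).
Proof.
have s464 : scale 464 = 20 by rewrite /scale; lra.
case: s => [[[x f] n] b]; case: a => [d|||] /=.
- case: ifP => // df [<-] /=; rewrite !scaleD scaleN -scale_norm.
  by apply: step_walk; rewrite scale_norm; exact: scale_le.
- by case: n => // n [<-]; exact: step_drop.
- case: n => //; case E: (fetch x b) => [b'|//] [<-]; apply: step_pickup => //.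
  exact: fetch_take.
- case: eqP => // -> /=; have -> : scale 0 = 0 by rewrite /scale mul0r.
  case: n => [|n [<-] /=]; last by rewrite s464; exact: step_unseal_carried.
  case E: (fetch x b) => [b'|//] [<-] /=; rewrite s464; apply: step_unseal_lying.
  exact: fetch_take.
Qed.

Lemma obey_run w s t : obey_all s w = Some t -> run (to_state s) (map to_action w) (to_state t).
Proof.
elim: w s => [|a w IH] s /=; first by case=> <-; exact: run_nil.
by case E: (obey s a) => [v|//] /= /IH; apply: run_cons; exact: obey_step.
Qed.

Lemma effort_miles w : miles (map to_action w) = scale (effort w).
Proof.
elim: w => [|a w IH]; first by rewrite /miles big_nil /scale mul0r.
by rewrite /= miles_cons IH; case: a => [d|||] /=; rewrite ?add0r // scaleD scale_norm.
Qed.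

(** A walk crosses all points between its ends. *)
Lemma net_visits w (x z y : R) : x <= z -> z <= x + scale (net w) -> same_point z y ->
  visits x (map to_action w) y.
Proof.
move=> + + zy; elim: w x => [|a w IH] x /=.
  rewrite /scale mul0r addr0 => xz zx.
  by have -> : x = z by apply/eqP; rewrite eq_le xz.
case: a => [d|||] /=; try exact: IH.
rewrite scaleD addrA => xz zx; case: (leP z (x + scale d)) => zd; last first.
  by right; apply: IH => //; exact: ltW.
left; case: (eqVneq (scale d) 0) => d0.
  exists 0; rewrite lexx ler01 mul0r addr0; split => //.
  by have -> : x = z by apply/eqP; rewrite eq_le xz -[x in _ <= x](addr0 x) -d0.
have dp : 0 < scale d by rewrite lt_neqAle eq_sym d0 /=; lra.
exists ((z - x) / scale d); rewrite divfK // [x + _]addrC subrK; split => //.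
by apply/andP; split; [rewrite divr_ge0 ?subr_ge0 // ltW|rewrite ler_pdivrMr // mul1r; lra].
Qed.

Lemma same_point_origin (y : R) : exists2 z, 0 <= z <= 100 & same_point z y.
Proof.
have /andP[fl fu] := floor_itv (y / 100); exists (y - 100 * (Num.floor (y / 100))%:~R).
  by rewrite intrD in fu; apply/andP; split; lra.
by apply/same_pointP; exists (- Num.floor (y / 100)); rewrite mulrNz mulrN.
Qed.

Lemma schedule_explores : exploration_from_dawn (map to_action schedule) /\
  duration (map to_action schedule) = 23 + 25 / 116.
Proof.
have net100 : scale (net schedule) = 100.
  have -> : net schedule = 2320 by vm_compute.
  by rewrite /scale; lra.
split; first split.
- exists (to_state (2320, 364, 0%N, [::])); split.
    have -> : dawn R = to_state (0, 464, 0%N, [::]).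
      by rewrite /dawn /to_state /scale mul0r /=; congr State; lra.
    by apply: obey_run; exact: schedule_runs.
  by rewrite /=; apply/at_baseP; exists 1; rewrite /scale; lra.
- move=> y; have [z /andP[z0 z1] zy] := same_point_origin y.
  by apply: net_visits z0 _ zy; rewrite net100 add0r.
- rewrite /duration effort_miles.
  have -> : effort schedule = 10772 by vm_compute.
  by rewrite /scale; lra.
Qed.

End UpperBound.

Theorem mainTheorem2 (R : realType) :
  (exists w : seq (action R),
     exploration_from_dawn w /\ duration w = 23 + 25 / 116) /\
  (forall w : seq (action R),
     exploration_from_dawn w -> 23 + 25 / 116 <= duration w).
Proof.
split; last exact: dawn_bound.
by exists (map (@to_action R) schedule); exact: schedule_explores.
Qed.
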